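(* Let $F$ be a 4-regular graph and suppose $C$ and $C'$ are two Euler systems of $F$. Then the matrix $M(C',C)$ over $GF(2)$ is nonsingular, and for every circuit partition $P$ of $F$, $$M(C',P)=M(C',C)\cdot M(C,P).$$
   Context: Graphs. A graph has a finite vertex set and a finite edge set; loops and parallel edges are allowed. Each edge consists of two distinct half-edges, each incident on a vertex (for a non-loop edge the two half-edges are incident on different vertices; for a loop, on the same vertex). The degree of a vertex is the number of half-edges incident on it; a graph is 4-regular if every vertex has degree 4. $c(F)$ denotes the number of connected components of $F$. Circuits. A circuit is a closed sequence $v_1,h_1,h_1',v_2,\dots,v_k,h_k,h_k',v_{k+1}=v_1$ such that for each $i$, $h_i$ and $h_i'$ are the two half-edges of an edge $e_i$, the half-edges $h_i'$ and $h_{i+1}$ are incident on $v_{i+1}$ (indices cyclic), and $e_i\neq e_j$ for $i\neq j$. Circuits are considered up to choice of starting point and of orientation. An Euler circuit is a circuit in which every edge appears exactly once. An Euler system of $F$ is a collection of Euler circuits, one in each connected component of $F$. Transitions and circuit partitions. A transition at a vertex $v$ of a 4-regular graph is one of the three pairings of the four half-edges incident at $v$ into two disjoint pairs. A circuit partition of $F$ is a partition of $E(F)$ into edge-disjoint circuits; choosing one transition at each vertex determines a circuit partition, so circuit partitions correspond to systems of choices of one transition at each vertex. Say that $P$ involves the transition chosen for it at $v$. Euler systems are exactly the circuit partitions with $c(F)$ circuits. Labels. Given an Euler system $C$ and a vertex $v$, orient the circuit of $C$ incident on $v$ (either way), so that two of the half-edges at $v$ are incoming and two are outgoing. The transition at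 $v$ used by $C$ is labeled $\phi$ with respect to $C$; the other transition that pairs each incoming half-edge with an outgoing one is labeled $\chi$; the transition pairing the two incoming half-edges together and the two outgoing half-edges together is labeled $\psi$. Interlacement. $\mathcal I(C)$ is the simple graph with vertex set $V(F)$ in which distinct $v,w$ are adjacent if and only if they appear in the (cyclic) order $v\dots w\dots v\dots w\dots$ on one of the circuits of $C$. $\mathcal A(\mathcal I(C))$ is its $V(F)\times V(F)$ adjacency matrix over $GF(2)$ (zero diagonal). Modified interlacement matrix. For an Euler system $C$ and a circuit partition $P$ of $F$, $M(C,P)$ is the $V(F)\times V(F)$ matrix over $GF(2)$ obtained from $\mathcal A(\mathcal I(C))$ by the following changes: (1) for each vertex $v$ at which $P$ involves the $\phi$ transition with respect to $C$, change the diagonal entry corresponding to $v$ to $1$ and every other entry of the $v$ column to $0$; (2) for each vertex $v$ at which $P$ involves the $\psi$ transition with respect to $C$, change the diagonal entry corresponding to $v$ to $1$. Since Euler systems are circuit partitions, $M(C',C)$ is defined for Euler systems $C,C'$. *)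

(* Defs.v *)
(* MathComp *)
From HB Require Import structures.
From mathcomp Require Import all_boot all_order all_algebra.
Set Implicit Arguments.
Unset Strict Implicit.
Unset Printing Implicit Defensive.

(* Loops and parallel edges are allowed. An edge is given by its two distinct
   half-edges, i.e. it is an orbit {h, twin h} of a fixed-point free
   involution. *)
Record graph := Graph {
  vertex : finType;
  half_edge : finType;
  twin : half_edge -> half_edge;
  inc : half_edge -> vertex;
  twinK : involutive twin;
  twin_neq : forall h, twin h != h
}.

Section Graph.
Variable F : graph.
Local Notation V := (vertex F).
Local Notation H := (half_edge F).
Implicit Types (v w : V) (h : H) (s : seq H) (C P : seq (seq H)) (K : {set V}).

Definition edge h : {set H} := [set h; twin h].

Definition halves_at v : {set H} := [set h | inc h == v].

Definition four_regular : bool := [forall v : V, #|halves_at v| == 4].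

Definition adj : rel V :=
  [rel v w | [exists h : H, (inc h == v) && (inc (twin h) == w)]].

Definition components : {set {set V}} :=
  equivalence_partition (connect adj) [set: V].

(* The closed sequence v_1, h_1, h_1', v_2, ..., v_k, h_k, h_k', v_1 is
   represented by [:: h_1; ...; h_k], since h_i' = twin h_i and v_i = inc h_i.
   A circuit, taken up to starting point and orientation, thus has several
   representatives s; all notions below that take circuits as arguments are
   stated on arbitrary representatives. *)
Definition circuit s : bool :=
  [&& s != [::], cycle [rel h h' | inc (twin h) == inc h'] s
    & uniq [seq edge h | h <- s]].

Definition circuit_partition P : bool :=
  all circuit P &&
  [forall h : H, count_mem (edge h) [seq edge h' | h' <- flatten P] == 1].

Definition euler_circuit K s : bool :=
  circuit s &&
  [forall h : H,
     count_mem (edge h) [seq edge h' | h' <- s] == (inc h \in K)].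

Definition euler_system C : bool :=
  all (fun s => [exists K in components, euler_circuit K s]) C &&
  [forall K in components, count (euler_circuit K) C == 1].

(* The pairs {h_i', h_(i+1)} at v = v_(i+1), over all circuits of P; for a
   circuit partition P of a 4-regular graph they form a pairing of
   halves_at v, namely the transition that P involves at v. *)
Definition transition P v : {set {set H}} :=
  [set B : {set H} |
    has (fun s => has (fun h => (inc (twin h) == v)
                                && (B == [set twin h; next s h])) s) P].

(* Half-edges leaving, resp. entering, v when each circuit of C is oriented
   as its representative. *)
Definition outgoing C v : {set H} :=
  [set h in halves_at v | h \in flatten C].
Definition incoming C v : {set H} :=
  [set h in halves_at v | twin h \in flatten C].

(* P involves the phi, resp. psi, transition at v with respect to C; reversing
   a circuit of C exchanges incoming and outgoing on it, so that the psi
   pairing does not depend on the representatives. *)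
Definition involves_phi C P v : bool := transition P v == transition C v.

Definition involves_psi C P v : bool :=
  transition P v == [set incoming C v; outgoing C v].

Definition interlaced C : rel V :=
  [rel v w | (v != w) &&
     has (fun s => [exists n : 'I_(size s),
            subseq [:: v; w; v; w] (rot n [seq inc h | h <- s])]) C].

(* V x V matrices are indexed through the enumeration enum_val of V. *)
Definition interlace_mx C : 'M['F_2]_#|V| :=
  \matrix_(i, j) (interlaced C (enum_val i) (enum_val j))%:R%R.

(* Columns at vertices where P involves the chi transition with respect to C,
   i.e. the only one that is neither phi nor psi, are left unchanged. *)
Definition mod_interlace_mx C P : 'M['F_2]_#|V| :=
  \matrix_(i, j)
    if involves_phi C P (enum_val j) then (i == j)%:R%R
    else if involves_psi C P (enum_val j) && (i == j) then 1%R
    else interlace_mx C i j.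

End Graph.

(* Main.v *)
Require Import Defs.
From HB Require Import structures.
From mathcomp Require Import all_boot all_order all_algebra.
From mathcomp Require Import zify.
Set Implicit Arguments.
Unset Strict Implicit.
Unset Printing Implicit Defensive.

Import GRing.Theory.

(** The idea is to read both matrices as intersection numbers modulo 2.  For an
Euler system [C] and a vertex [u], let [half C u] be the indicator function,
with values in GF(2), of the half of the Euler circuit at [u] that runs from
one passage through [u] to the other.  Let [partner P b] be the half-edge that
the transition of a circuit partition [P] pairs with the half-edge [b].  Then,
for any half-edge [b] at [v],

  [M(C,P)_(u,v) = half C u b + half C u (partner P b)]

([mod_interlace_mx_half]).  Indeed, along [C] the function [half C u] changes
its value exactly at the passages through [u], which accounts for the phi
columns.  Its values on the two half-edges leaving a vertex [v] other than [u]
differ exactly when the half circuit contains a single passage through [v],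
that is, when [u] and [v] are interlaced; and the psi and chi transitions pair
[b] with a half-edge reached from [b] by such a comparison, followed for chi by
one passage of [C] through [v].

Given a row [u] of [M(C',P)], consider

  [z h = half C' u h + \sum_w M(C',C)_(u,w) * half C w h].

Passing through a vertex [w] along [C] changes the first summand by
[M(C',C)_(u,w)], by the formula above applied to [P = C], and changes the sum
by the same amount, since only [half C w] changes there.  So [z] is constant
along the circuits of [C], hence takes a single value on the half-edges at a
vertex, because all of them lie on one circuit of [C]
([invariant_at_vertex]).  Comparing [z b] with [z (partner P b)] gives
[M(C',P) = M(C',C) M(C,P)].  For [P = C'] the left-hand side is the identity
matrix, whence the invertibility of [M(C',C)]. *)

(** * Circuit partitions and the pairings of half-edges they define *)

Section Partner.
Variable F : graph.
Local Notation V := (vertex F).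
Local Notation H := (half_edge F).
Implicit Types (u v : V) (h b : H) (s : seq H) (P : seq (seq H)).

Lemma edge_eq h h' : (edge h' == edge h) = (h' \in [set h; twin h]).
Proof.
apply/eqP/idP => [/setP/(_ h')|]; first by rewrite !inE eqxx => <-.
by rewrite !inE => /orP[]/eqP-> //; rewrite /edge twinK setUC.
Qed.

Lemma count_edge h s :
  count_mem (edge h) [seq edge h' | h' <- s]
    = count_mem h s + count_mem (twin h) s.
Proof.
rewrite count_map -count_predUI [X in _ = _ + X](@eq_count _ _ pred0).
  rewrite count_pred0 addn0; apply: eq_count => h' /=.
  by rewrite edge_eq !inE.
by move=> h' /=; case: eqP => // ->; rewrite eq_sym (negbTE (twin_neq h)).
Qed.

Lemma flatten_uniq_inj (T : eqType) (ss : seq (seq T)) (s1 s2 : seq T) x :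
  uniq (flatten ss) -> s1 \in ss -> s2 \in ss -> x \in s1 -> x \in s2 ->
  s1 = s2.
Proof.
elim: ss => //= s ss IH; rewrite cat_uniq => /and3P[_ /hasPn dis uss].
have out t : t \in ss -> x \in t -> x \notin s.
  by move=> tss xt; apply: dis; apply/flattenP; exists t.
rewrite !inE => /orP[/eqP->|s1ss] /orP[/eqP->|s2ss] // x1 x2.
- by have := out _ s2ss x2; rewrite x1.
- by have := out _ s1ss x1; rewrite x2.
exact: IH.
Qed.

Section Partition.
Variables (P : seq (seq H)) (cP : circuit_partition P).

(** The two half-edges of an edge are traversed in total exactly once; this is
what orients the edges along the chosen representatives of the circuits. *)
Lemma count_halves h :
  count_mem h (flatten P) + count_mem (twin h) (flatten P) = 1.
Proof. by case/andP: cP => _ /forallP/(_ h)/eqP; rewrite count_edge. Qed.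

Lemma flatten_uniq : uniq (flatten P).
Proof.
apply: count_mem_uniq => h; have := count_halves h.
rewrite -has_pred1 has_count.
by case: (count_mem h _) => [|[|n]].
Qed.

Lemma mem_twin h : (twin h \in flatten P) = (h \notin flatten P).
Proof.
have := count_halves h; rewrite !(count_uniq_mem _ flatten_uniq).
by do 2!case: (_ \in _).
Qed.

Lemma circuit_uniq s : s \in P -> uniq s.
Proof.
case/andP: cP => /allP cir _ /cir /and3P[_ _].
exact: map_uniq.
Qed.

Lemma inc_next s h : s \in P -> h \in s -> inc (next s h) = inc (twin h).
Proof.
case/andP: cP => /allP cir _ /cir /and3P[_ cyc _] hs.
by rewrite (eqP (next_cycle cyc hs)).
Qed.

End Partition.

Definition circuit_at P h : seq H := nth [::] P (find (fun s => h \in s) P).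

Lemma circuit_atP P h :
  h \in flatten P -> (circuit_at P h \in P) && (h \in circuit_at P h).
Proof.
case/flattenP=> s sP hs; have hasP : has (fun s => h \in s) P.
  by apply/hasP; exists s.
by rewrite mem_nth -?has_find // (nth_find [::] hasP).
Qed.

(** The half-edge paired with [b] by the transition that [P] involves at the
vertex of [b].  A half-edge in [flatten P] leaves its vertex, so it is paired
with the twin of its predecessor; the other ones are paired with the successor
of their twin. *)
Definition partner P b : H :=
  if b \in flatten P then twin (prev (circuit_at P b) b)
  else next (circuit_at P (twin b)) (twin b).

Section PartnerTheory.
Variables (P : seq (seq H)) (cP : circuit_partition P).

Lemma circuit_at_eq s h : s \in P -> h \in s -> circuit_at P h = s.
Proof.
move=> sP hs; have hP : h \in flatten P by apply/flattenP; exists s.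
have /andP[cP' hc] := circuit_atP hP.
exact: flatten_uniq_inj (flatten_uniq cP) cP' sP hc hs.
Qed.

Lemma partner_twin s h : s \in P -> h \in s -> partner P (twin h) = next s h.
Proof.
move=> sP hs; have hP : h \in flatten P by apply/flattenP; exists s.
by rewrite /partner mem_twin // hP twinK (circuit_at_eq sP hs).
Qed.

Lemma partner_next s h : s \in P -> h \in s -> partner P (next s h) = twin h.
Proof.
move=> sP hs; have ns : next s h \in s by rewrite mem_next.
have nP : next s h \in flatten P by apply/flattenP; exists s.
by rewrite /partner nP (circuit_at_eq sP ns) prev_next ?(circuit_uniq cP sP).
Qed.

(** Every half-edge is the arrival [twin h] or the departure [next s h] of a
passage of one of the circuits through a vertex. *)
Lemma partner_ind (Q : H -> Prop) :
  (forall s h, s \in P -> h \in s -> Q (twin h)) ->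
  (forall s h, s \in P -> h \in s -> Q (next s h)) ->
  forall b, Q b.
Proof.
move=> Qt Qn b; case: (boolP (b \in flatten P)) => [/flattenP[s sP bs]|].
  have us := circuit_uniq cP sP.
  by rewrite -(next_prev us b); apply: Qn; rewrite ?mem_prev.
rewrite -mem_twin // => /flattenP[s sP bs].
by rewrite -[b]twinK; apply: Qt sP bs.
Qed.

Lemma partnerK b : partner P (partner P b) = b.
Proof.
by elim/partner_ind: b => s h sP hs;
  rewrite ?(partner_twin sP hs) ?(partner_next sP hs) ?(partner_twin sP hs).
Qed.

Lemma inc_partner b : inc (partner P b) = inc b.
Proof.
by elim/partner_ind: b => s h sP hs;
  rewrite ?(partner_twin sP hs) ?(partner_next sP hs) (inc_next cP sP hs).
Qed.

Lemma mem_partner b : (partner P b \in flatten P) = (b \notin flatten P).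
Proof.
have fl s h : s \in P -> h \in s ->
    (h \in flatten P) && (next s h \in flatten P).
  move=> sP hs; apply/andP; split; apply/flattenP; exists s => //.
  by rewrite mem_next.
elim/partner_ind: b => s h sP hs; have /andP[hP nP] := fl _ _ sP hs.
  by rewrite (partner_twin sP hs) mem_twin // nP hP.
by rewrite (partner_next sP hs) mem_twin // nP hP.
Qed.

Lemma partner_neq b : partner P b != b.
Proof.
by apply/eqP => e; have := mem_partner b; rewrite e; case: (_ \in _).
Qed.

Lemma mem_transition v (B : {set H}) :
  reflect (exists2 b, inc b = v & B = [set b; partner P b])
    (B \in transition P v).
Proof.
rewrite inE; apply: (iffP hasP) => [[s sP /hasP[h hs /andP[/eqP hv /eqP->]]]|].
  by exists (twin h); rewrite ?(partner_twin sP hs).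
case=> b bv ->; elim/partner_ind: b bv => s h sP hs hv; exists s => //;
  apply/hasP; exists h => //.
  by rewrite hv (partner_twin sP hs) !eqxx.
by rewrite -(inc_next cP sP hs) hv (partner_next sP hs) setUC !eqxx.
Qed.

End PartnerTheory.
End Partner.

(** * Auxiliary facts on GF(2) and on sequences *)

Lemma F2_addrr (x : 'F_2) : (x + x = 0)%R.
Proof. exact/addrr_pchar2/pchar_Fp. Qed.

Lemma subseq_map_consP (T U : eqType) (f : T -> U) x p t :
  subseq (x :: p) (map f t) ->
  exists t1 y t2, [/\ t = t1 ++ y :: t2, f y = x & subseq p (map f t2)].
Proof.
elim: t => //= a t IH; case: eqP => [-> sp|_ /IH[t1 [y [t2 [-> fy sp]]]]].
  by exists [::], a, t.
by exists (a :: t1), y, t2.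
Qed.

Lemma rot1_rot (T : Type) n (s : seq T) :
  0 < size s -> exists k : 'I_(size s), rot 1 (rot n s) = rot k s.
Proof.
move=> s0; have [m lt_m ->] : exists2 m, m < size s & rot n s = rot m s.
  case: (ltnP n (size s)) => [lt_n|le_n]; first by exists n.
  by exists 0 => //; rewrite rot_oversize // rot0.
rewrite -rotS //; case: (ltnP m.+1 (size s)) => [lt|le].
  by exists (Ordinal lt).
by exists (Ordinal s0); rewrite rot_oversize // rot0.
Qed.

(** * Euler systems *)

Section EulerSystem.
Variables (F : graph) (reg : four_regular F).
Local Notation V := (vertex F).
Local Notation H := (half_edge F).
Implicit Types (u v : V) (h b c : H) (s : seq H) (P : seq (seq H)).

Lemma components_partition : partition (components F) [set: V].
Proof.
apply: equivalence_partitionP => x y z _ _ _.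
split=> [|xy]; first exact: connect0.
have sym : connect_sym (@adj F).
  apply: sym_connect_sym => v w; apply/existsP/existsP => -[h hvw];
    by exists (twin h); rewrite twinK andbC.
by apply/idP/idP; apply: connect_trans; rewrite ?xy // sym.
Qed.

(** The circuit of the component of an edge traverses it once, and a circuit of
[C] is an Euler circuit of only one component; so summing over [C] counts each
edge once. *)
Lemma euler_circuit_partition (C : seq (seq H)) :
  euler_system C -> circuit_partition C.
Proof.
case/andP=> /allP eC /forall_inP oneC; apply/andP; split.
  by apply/allP => s /eC /existsP[K /andP[_ /andP[]]].
apply/forallP => h; rewrite count_map count_flatten.
have /and3P[/eqP cov triv _] := components_partition.
have hcov : inc h \in cover (components F) by rewrite cov.
set K := pblock (components F) (inc h).
have hK : inc h \in K by rewrite mem_pblock.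
rewrite -(eqP (oneC K (pblock_mem hcov))) -sumn_count; apply/eqP.
congr sumn; apply/eq_in_map => s /eC /exists_inP[K' K'c eK'].
rewrite -count_map; case: (boolP (euler_circuit K s)) => [eK|neK].
  by case/andP: eK => _ /forallP/(_ h)/eqP->; rewrite hK.
case/andP: (eK') => _ /forallP/(_ h)/eqP->; case: (boolP (_ \in _)) => // hK'.
by rewrite -(def_pblock triv K'c hK') -/K (negbTE neK) in eK'.
Qed.

Section Fixed.
Variables (C : seq (seq H)) (eC : euler_system C).
Let cC := euler_circuit_partition eC.
Local Notation tau := (partner C).

(** The Euler circuit through [b] traverses all the edges of its component, in
particular those incident to the vertex of [b]. *)
Lemma euler_circuit_through s b c :
  s \in C -> b \in s -> inc c = inc b -> (c \in s) || (twin c \in s).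
Proof.
case/andP: (eC) => /allP eC' _ sC bs bc; have /exists_inP[K _] := eC' s sC.
case/andP=> _ /forallP ce; have := ce c.
have occ x : (x \in s) = (0 < count_mem x s) by rewrite -has_pred1 has_count.
have bK : inc b \in K.
  have := ce b; rewrite count_edge; case: (inc b \in K) => //.
  by rewrite addn_eq0 -leqn0 leqNgt -occ bs.
by rewrite bc bK count_edge !occ; do 2!case: (count_mem _ _) => [|?].
Qed.

Lemma mem_circuit s b c :
  s \in C -> b \in s -> c \in flatten C -> inc c = inc b -> c \in s.
Proof.
move=> sC bs cF bc; have /orP[//|ts] := euler_circuit_through sC bs bc.
have: twin c \in flatten C by apply/flattenP; exists s.
by rewrite mem_twin // cF.
Qed.

(** The two assumptions on [f] say that it is constant along the circuits of
[C], and a single circuit of [C] contains the edges at a given vertex. *)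
Lemma invariant_at_vertex (T : eqType) (f : H -> T) b c :
  (forall h, f (twin h) = f h) -> (forall h, f (tau h) = f h) ->
  inc b = inc c -> f b = f c.
Proof.
(* The half-edge of an edge that its circuit in [C] traverses forwards. *)
move=> ft fp; pose rep h := if h \in flatten C then h else twin h.
have repF h : rep h \in flatten C.
  by rewrite /rep; case: ifP => // /negbT; rewrite -mem_twin.
have fs s x y : s \in C -> x \in s -> y \in s -> f x = f y.
  move=> sC xs ys; have us := circuit_uniq cC sC.
  have: cycle [rel x y | f x == f y] s.
    apply: cycle_from_next => // h hs /=.
    by rewrite -(partner_twin cC sC hs) fp ft.
  rewrite cycle_all2rel => [/allrelP/(_ _ _ xs ys)/eqP //|].
  by move=> z t w /= /eqP-> /eqP->.
have frep h : f (rep h) = f h by rewrite /rep; case: ifP.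
have through h : exists2 s, s \in C & (h \in s) || (twin h \in s).
  by case/flattenP: (repF h) => s sC; rewrite /rep; case: ifP => _ hs;
    exists s; rewrite ?hs ?orbT.
have [s sC] := through b.
have fout x : (x \in s) || (twin x \in s) -> exists2 y, y \in s & f x = f y.
  by case/orP=> xs; [exists x | exists (twin x); rewrite ?ft].
move=> bs bc; have cs : (c \in s) || (twin c \in s).
  case/orP: bs => bs; first exact: euler_circuit_through sC bs _.
  have ns : next s (twin b) \in s by rewrite mem_next.
  apply: (euler_circuit_through sC ns).
  by rewrite (inc_next cC sC bs) twinK.
by have [x xs ->] := fout _ bs; have [y ys ->] := fout _ cs; exact: fs sC xs ys.
Qed.

(** This is [outgoing C] or [incoming C] at the vertex of [b], whichever contains
[b]; it lets statements about [b] cover both directions. *)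
Definition aligned b : {set H} :=
  [set h in halves_at (inc b) | (h \in flatten C) == (b \in flatten C)].

Lemma alignedE b :
  aligned b = if b \in flatten C then outgoing C (inc b)
              else incoming C (inc b).
Proof.
by case: ifP => bC; apply/setP=> h;
  rewrite !inE ?mem_twin // bC ?eqbF_neg ?eqb_id.
Qed.

(** Passing along [C] exchanges incoming and outgoing half-edges, so each kind
makes up half of the four half-edges at the vertex. *)
Lemma card_aligned b : #|aligned b| = 2.
Proof.
have /eqP := forallP reg (inc b).
rewrite -(cardsID [set h | (h \in flatten C) == (b \in flatten C)]).
rewrite (_ : _ :&: _ = aligned b); last by apply/setP=> h; rewrite !inE.
rewrite (_ : _ :\: _ = tau @: aligned b).
  rewrite card_imset; last exact: inv_inj (partnerK cC).
  by rewrite addnn => e; apply: double_inj.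
apply/setP=> h; rewrite !inE; apply/andP/imsetP => [[nh /eqP hv]|[g]].
  exists (tau h); last by rewrite partnerK.
  rewrite !inE inc_partner // hv eqxx mem_partner //.
  by move: nh; do 2!case: (_ \in _).
rewrite !inE => /andP[/eqP gv /eqP gb] ->.
by rewrite inc_partner // gv eqxx mem_partner // gb; case: (_ \in _).
Qed.

Lemma aligned2 b c : c \in aligned b -> c != b -> aligned b = [set b; c].
Proof.
move=> cb nbc; apply/esym/eqP; rewrite eqEcard card_aligned cards2 eq_sym nbc.
by rewrite andbT; apply/subsetP=> h; rewrite !inE => /orP[/eqP->|/eqP->];
  rewrite ?eqxx //; move: cb; rewrite !inE.
Qed.

Lemma ex_aligned b : exists2 c, c \in aligned b & c != b.
Proof.
have := card_aligned b; rewrite (cardsD1 b) !inE !eqxx add1n => -[].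
by move/eqP/cards1P=> [c /setP/(_ c)]; rewrite !inE eqxx => /andP[]; exists c;
  rewrite ?inE.
Qed.

(** Here [b] and [c] are the two half-edges with one direction at a vertex: phi
pairs [b] with [tau b], psi with [c], and chi with [tau c]. *)
Lemma halves_at_cases b c h : c \in aligned b -> c != b -> inc h = inc b ->
  h \in [:: b; c; tau b; tau c].
Proof.
move=> cb nbc hb; rewrite !inE.
have al x : x \in aligned b -> (x == b) || (x == c).
  by rewrite (aligned2 cb nbc) !inE.
case: (boolP (h \in aligned b)) => [/al/orP[]->|]; rewrite ?orbT //.
rewrite inE inE hb eqxx /= => nh.
have: tau h \in aligned b.
  rewrite !inE inc_partner // hb mem_partner // eqxx /=.
  by move: nh; do 2!case: (_ \in _).
by case/al/orP=> /eqP<-; rewrite partnerK ?eqxx ?orbT.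
Qed.

(** The two half-edges that leave a vertex lie on the same circuit of [C], which
therefore visits the vertex twice. *)
Lemma count_vertex s h :
  s \in C -> h \in s -> count [pred x | inc x == inc h] s = 2.
Proof.
move=> sC hs; have hF : h \in flatten C by apply/flattenP; exists s.
rewrite -(card_aligned h) -size_filter.
have us : uniq [seq x <- s | [pred x | inc x == inc h] x].
  by rewrite filter_uniq ?(circuit_uniq cC sC).
rewrite -(card_uniqP us); apply: eq_card => x.
rewrite mem_filter !inE hF eqb_id /=; case: eqP => //= xh.
apply/idP/idP => [xs|xF]; first by apply/flattenP; exists s.
exact: mem_circuit xF xh.
Qed.

Lemma count_vertex_02 s u : s \in C -> 
  count [pred x | inc x == u] s = 0 \/ count [pred x | inc x == u] s = 2.
Proof.
move=> sC; case: (boolP (has [pred x | inc x == u] s)).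
  case/hasP=> h hs /eqP <-.
  by right; apply: count_vertex.
by rewrite has_count -leqNgt leqn0 => /eqP; left.
Qed.

(** * Half circuits of an Euler system *)

(** Counting the visits to [u] modulo 2, from the start of the chosen
representative up to an edge, gives the indicator function of the part of the
circuit between its two visits to [u]. *)
Definition half u h : 'F_2 :=
  let g := if h \in flatten C then h else twin h in
  let s := circuit_at C g in
  ((count [pred x | inc x == u] (take (index g s).+1 s))%:R)%R.

Lemma half_twin u h : half u (twin h) = half u h.
Proof. by rewrite /half mem_twin // if_neg twinK; case: ifP. Qed.

Lemma halfE u s h : s \in C -> h \in s ->
  half u h = ((count [pred x | inc x == u] (take (index h s).+1 s))%:R)%R.
Proof.
move=> sC hs; have hF : h \in flatten C by apply/flattenP; exists s.
by rewrite /half hF (circuit_at_eq cC sC hs).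
Qed.

(** When [h] is the last half-edge of its representative [s], the count starts
again from zero; this is consistent because [s] visits [u] an even number of
times. *)
Lemma half_next u s h : s \in C -> h \in s ->
  (half u (next s h) = half u h + (inc (next s h) == u)%:R)%R.
Proof.
move=> sC hs; have us := circuit_uniq cC sC.
rewrite (halfE _ sC hs) (halfE _ sC); last by rewrite mem_next.
have lt_i : index h s < size s by rewrite index_mem.
have [lt_i1|ge_i1] := ltnP (index h s).+1 (size s).
  have -> : next s h = nth h s (index h s).+1.
    rewrite next_nth hs; case: (s) lt_i1 => //= y s' lt_i1.
    exact: set_nth_default.
  by rewrite index_uniq // (take_nth h) // -cats1 count_cat /= addn0 natrD.
have -> : next s h = nth h s 0.
  rewrite next_nth hs; case: (s) lt_i ge_i1 => //= y s' _ ge.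
  by rewrite nth_default.
rewrite index_uniq ?(leq_trans _ lt_i) //.
rewrite [take (index h s).+1 s]take_oversize //.
have -> : ((count [pred x | inc x == u] s)%:R = 0 :> 'F_2)%R.
  by case: (count_vertex_02 u sC) => -> //; apply/val_inj.
by case: (s) lt_i => //= y s' _; rewrite take0 /= addn0 add0r.
Qed.

Lemma half_partner u h : (half u (tau h) = half u h + (inc h == u)%:R)%R.
Proof.
elim/(partner_ind cC): h => s h sC hs.
  by rewrite (partner_twin cC sC hs) half_twin half_next // (inc_next cC sC hs).
rewrite (partner_next cC sC hs) half_twin (half_next _ sC hs).
by rewrite -addrA F2_addrr addr0.
Qed.

(** Summing [half_next] along a segment of a circuit, from [b] to [c]. *)
Lemma half_segment u s n p1 b p2 c p3 :
  s \in C -> rot n s = p1 ++ b :: p2 ++ c :: p3 ->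
  (half u c = half u b + (count [pred x | inc x == u] (rcons p2 c))%:R)%R.
Proof.
move=> sC rs; have us := circuit_uniq cC sC.
pose e := [rel x y | half u y == half u x + (inc y == u)%:R]%R.
have: cycle e (rot n s).
  by rewrite rot_cycle; apply: cycle_from_next => // h hs /=; rewrite half_next.
rewrite rs.
have -> : p1 ++ b :: p2 ++ c :: p3
    = rot (size (b :: rcons p2 c ++ p3)) (b :: rcons p2 c ++ p3 ++ p1).
  by rewrite catA -cat_cons rot_size_cat cat_rcons.
rewrite rot_cycle /= rcons_cat cat_path => /andP[+ _].
rewrite -[in half u c](last_rcons b p2 c).
elim: (rcons p2 c) b {rs} => [|x p IH] b /=; first by rewrite addr0.
by case/andP=> /eqP hx /IH->; rewrite hx natrD addrA.
Qed.

(** The circuit through [b] and [c] is cut by them into two segments, both free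
of [inc b].  It visits [u] either not at all or twice, and [u] is interlaced
with [inc b] exactly when each segment contains one of the visits; by
[half_segment] this is when [half u] separates [b] and [c]. *)
Lemma interlaced_half u b c : u != inc b -> inc c = inc b -> c != b ->
  b \in flatten C -> c \in flatten C ->
  (half u b + half u c = (interlaced C u (inc b))%:R)%R.
Proof.
move=> ub cb nbc bF cF.
have cal : c \in aligned b by rewrite !inE cb bF cF eqxx.
have vu : (inc b == u) = false by rewrite eq_sym (negbTE ub).
rewrite /interlaced /= ub /=; case: hasP => [[s sC /existsP[n]]|nint].
  rewrite -map_rot => /subseq_map_consP[p0 [h1 [q1 [rs h1u]]]].
  move=> /subseq_map_consP[p1 [h2 [q2 [q1E h2v]]]].
  move=> /subseq_map_consP[p2 [h3 [q3 [q2E h3u]]]].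
  move=> /subseq_map_consP[p3 [h4 [q4 [q3E h4v _]]]].
  have rs' : rot n s = (p0 ++ h1 :: p1) ++ h2 :: (p2 ++ h3 :: p3) ++ h4 :: q4.
    by rewrite rs q1E q2E q3E -!catA.
  have memr x : x \in rot n s -> x \in flatten C.
    by rewrite mem_rot => xs; apply/flattenP; exists s.
  have h1s : h1 \in s by rewrite -(mem_rot n) rs mem_cat inE eqxx orbT.
  have h24 : h4 != h2.
    have: uniq (rot n s) by rewrite rot_uniq (circuit_uniq cC sC).
    rewrite rs' cat_uniq => /and3P[_ _ /= /andP[nin _]].
    by apply: contraNneq nin => <-; rewrite mem_cat inE eqxx orbT.
  have h2F : h2 \in flatten C.
    by apply: memr; rewrite rs' !(mem_cat, inE) eqxx ?orbT.
  have h4F : h4 \in flatten C.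
    by apply: memr; rewrite rs' !(mem_cat, inE) eqxx ?orbT.
  (* [h2] and [h4] are the two half-edges leaving the vertex of [b]. *)
  have -> : (half u b + half u c = half u h2 + half u h4)%R.
    have al x : x \in flatten C -> inc x = inc b -> (x == b) || (x == c).
      move=> xF xb; have : x \in aligned b by rewrite !inE xb xF bF eqxx.
      by rewrite (aligned2 cal nbc) !inE.
    move: h24; case/orP: (al h2 h2F h2v) => /eqP->;
      by case/orP: (al h4 h4F h4v) => /eqP->; rewrite ?eqxx // addrC.
  rewrite (half_segment u sC rs') addrA F2_addrr add0r.
  have := count_vertex sC h1s; rewrite -(permP (permEl (perm_rot n s))) rs' h1u.
  rewrite -cats1 !count_cat /= !count_cat /= h1u h2v h3u h4v eqxx vu => tot.
  rewrite [X in (X%:R)%R](_ : _ = 1) //.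
  by move: tot; clear; lia.
(* Otherwise, an odd number of visits to [u] between [b] and [c] would give an
   interlacing pattern in the rotation of [s] that starts just after [b]. *)
case/flattenP: (bF) => s sC bs; have cs := mem_circuit sC bs cF cb.
have us := circuit_uniq cC sC; rewrite eq_sym in nbc.
case: (rot_to_arc us bs cs nbc) => n p1 p2 _ _ rs.
rewrite (half_segment (p1 := [::]) u sC rs) addrA F2_addrr add0r.
have := count_vertex_02 u sC.
rewrite -(permP (permEl (perm_rot n s))) rs.
rewrite -cats1 /= !count_cat /= cb vu !addn0 add0n.
set n1 := count _ p1; set n2 := count _ p2 => n12.
case: (eqVneq n1 1) => [n1E|n1N]; last first.
  have [->|->] : n1 = 0 \/ n1 = 2 by move: n12 n1N; clear; lia.
    by [].
  exact/val_inj.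
case: nint; exists s => //; apply/existsP.
have s0 : 0 < size s by case: (s) bs.
have [k kE] := rot1_rot n s0; exists k.
have once p :
    count [pred x | inc x == u] p = 1 -> subseq [:: u] (map (@inc F) p).
  move=> p1'; rewrite sub1seq.
  have: has [pred x | inc x == u] p by rewrite has_count p1'.
  case/hasP=> x xp /eqP <-; exact: (map_f (@inc F) xp).
rewrite -map_rot -kE rs rot1_cons -cats1 -catA !map_cat /= cb.
apply: (@cat_subseq _ [:: u]); first exact: once.
rewrite /= eqxx; apply: (@cat_subseq _ [:: u] [:: inc b]) => //.
by apply: once; move: n12; rewrite -/n2 n1E; clear; lia.
Qed.

(** The circuit visits this vertex only at [b] and at [c], so the only visit
after [b] and up to [c] is the one at [c]. *)
Lemma half_at_vertex b c : inc c = inc b -> c != b ->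
  b \in flatten C -> c \in flatten C ->
  (half (inc b) b + half (inc b) c = 1)%R.
Proof.
move=> cb nbc bF cF; case/flattenP: (bF) => s sC bs.
have cs := mem_circuit sC bs cF cb.
have us := circuit_uniq cC sC; rewrite eq_sym in nbc.
case: (rot_to_arc us bs cs nbc) => n p1 p2 _ _ rs.
rewrite (half_segment (p1 := [::]) (inc b) sC rs) addrA F2_addrr add0r.
have := count_vertex sC bs; rewrite -(permP (permEl (perm_rot n s))) rs.
rewrite -cats1 /= !count_cat /= cb eqxx => tot.
rewrite [X in (X%:R)%R](_ : _ = 1) //.
by move: tot; clear; lia.
Qed.
(** For incoming [b] and [c], replacing both by their partners adds the same
constant twice. *)
Lemma half_aligned u b c : c \in aligned b -> c != b ->
  (half u b + half u c
     = if u == inc b then 1 else (interlaced C u (inc b))%:R)%R.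
Proof.
wlog bF : b c / b \in flatten C => [hwlog|] cal nbc.
  case: (boolP (b \in flatten C)) => [/hwlog|nbF]; first exact.
  move: cal; rewrite !inE (negbTE nbF) eqbF_neg => /andP[/eqP cb ncF].
  have := hwlog (tau b) (tau c); rewrite !half_partner !inc_partner // cb.
  rewrite mem_partner // => <- //; first by rewrite addrACA F2_addrr addr0.
    by rewrite !inE !inc_partner // !mem_partner // cb nbF ncF eqxx.
  by rewrite (inj_eq (inv_inj (partnerK cC))).
move: cal; rewrite !inE bF eqb_id => /andP[/eqP cb cF].
case: eqVneq => [->|ub]; first exact: half_at_vertex.
exact: interlaced_half.
Qed.

(** * Matrix entries as intersection numbers *)

Section Column.
Variables (P : seq (seq H)) (cP : circuit_partition P).
Local Notation sigma := (partner P).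

Lemma partner_cases b c : c \in aligned b -> c != b ->
  [|| sigma b == c, sigma b == tau b | sigma b == tau c].
Proof.
move=> cal nbc; have := halves_at_cases cal nbc (inc_partner cP b).
by rewrite !inE (negbTE (partner_neq cP b)).
Qed.

(** Two pairings of four elements coincide as soon as they agree on one of
them. *)
Lemma involves_phiE b :
  involves_phi C P (inc b) = (sigma b == tau b).
Proof.
apply/eqP/eqP => [eqT|sb].
  have : [set b; sigma b] \in transition C (inc b).
    by rewrite -eqT; apply/(mem_transition cP); exists b.
  case/(mem_transition cC)=> x xb bx; have := partner_neq cP b.
  have : b \in [set x; tau x] by rewrite -bx !inE eqxx.
  have : sigma b \in [set x; tau x] by rewrite -bx !inE eqxx orbT.
  by rewrite !inE => /orP[]/eqP-> /orP[]/eqP->; rewrite ?partnerK ?eqxx.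
have [c cal nbc] := ex_aligned b.
have [/eqP cb cF] : inc c == inc b /\ (c \in flatten C) = (b \in flatten C).
  by move: cal; rewrite !inE => /andP[-> /eqP].
have sc : sigma c = tau c.
  have bal : b \in aligned c by rewrite !inE cb cF !eqxx.
  rewrite eq_sym in nbc; case/or3P: (partner_cases bal nbc) => /eqP // e.
    have := mem_partner cC b; have := partnerK cP c.
    rewrite e sb => ->; rewrite cF.
    by case: (_ \in _).
  have := partnerK cP c; rewrite e -sb partnerK // => e'.
  by rewrite e' eqxx in nbc.
have same h : inc h = inc b -> sigma h = tau h.
  move/(halves_at_cases cal nbc); rewrite !inE => /or4P[] /eqP-> //.
    by rewrite -{1}sb !partnerK.
  by rewrite -{1}sc !partnerK.
apply/setP=> B; apply/(mem_transition cP)/(mem_transition cC) => -[h hb ->];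
  by exists h => //; rewrite same.
Qed.

(** A pairing of four elements is determined by the partner of one of them; and
[c] is the only other half-edge directed like [b]. *)
Lemma involves_psiE b c : c \in aligned b -> c != b ->
  involves_psi C P (inc b) = (sigma b == c).
Proof.
move=> cal nbc.
have [/eqP cb cF] : inc c == inc b /\ (c \in flatten C) = (b \in flatten C).
  by move: cal; rewrite !inE => /andP[-> /eqP].
have blocks : [set incoming C (inc b); outgoing C (inc b)]
            = [set aligned b; aligned (tau b)].
  rewrite !alignedE inc_partner // mem_partner //.
  by case: (b \in _) => //=; rewrite setUC.
rewrite /involves_psi blocks.
have tcal : tau c \in aligned (tau b).
  by rewrite !inE !inc_partner // !mem_partner // cb cF !eqxx.
have ntbc : tau c != tau b by rewrite (inj_eq (inv_inj (partnerK cC))).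
apply/eqP/eqP => [eqT|sb].
  have : [set b; sigma b] \in [set aligned b; aligned (tau b)].
    by rewrite -eqT; apply/(mem_transition cP); exists b.
  rewrite !inE => /orP[] /eqP.
    rewrite (aligned2 cal nbc) => /setP/(_ (sigma b)).
    by rewrite !inE eqxx orbT (negbTE (partner_neq cP b)) => /esym/eqP.
  move=> /setP/(_ b); rewrite !inE eqxx inc_partner // eqxx mem_partner //.
  by case: (_ \in _).
have sigma_tb : sigma (tau b) = tau c.
  case/or3P: (partner_cases tcal ntbc) => /eqP //; rewrite partnerK // => e.
    have := partnerK cP (tau b); rewrite e sb => e'.
    by have := mem_partner cC b; rewrite -e' cF; case: (_ \in _).
  have := partnerK cP (tau b); rewrite e -sb partnerK // => e'.
  by have := partner_neq cC b; rewrite -e' eqxx.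
apply/setP=> B; rewrite in_set2 (aligned2 cal nbc) (aligned2 tcal ntbc).
apply/(mem_transition cP)/orP => [[h hb ->]|[/eqP->|/eqP->]].
- have := halves_at_cases cal nbc hb; rewrite !inE => /or4P[] /eqP->.
  + by left; rewrite sb.
  + by left; rewrite -sb partnerK // setUC.
  + by right; rewrite sigma_tb.
  by right; rewrite -sigma_tb partnerK // setUC.
- by exists b; rewrite ?sb.
by exists (tau b); rewrite ?sigma_tb ?inc_partner.
Qed.

(** The three cases follow from [half_partner] and [half_aligned].  On the
diagonal both contribute a jump by 1: chi combines the two and gives 0, whereas
phi and psi use one of them and give 1. *)
Lemma mod_interlace_mx_half i j b : inc b = enum_val j ->
  mod_interlace_mx C P i j
    = (half (enum_val i) b + half (enum_val i) (sigma b))%R.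
Proof.
move=> bj; have [c cal nbc] := ex_aligned b.
have cb : inc c = inc b by move: cal; rewrite !inE => /andP[/eqP].
rewrite mxE mxE -bj involves_phiE (involves_psiE cal nbc).
have -> : (i == j) = (enum_val i == inc b) by rewrite bj (inj_eq enum_val_inj).
have irr : interlaced C (inc b) (inc b) = false by rewrite /interlaced /= eqxx.
have [/eqP e|/eqP e|/eqP e] := or3P (partner_cases cal nbc); rewrite e.
- case: ifP => [/eqP e'|_]; last by rewrite eqxx /= half_aligned.
  have := mem_partner cC b; move: cal; rewrite -e' !inE => /andP[_ /eqP->].
  by case: (_ \in _).
- by rewrite eqxx half_partner addrA F2_addrr add0r eq_sym.
rewrite (inj_eq (inv_inj (partnerK cC))) (negbTE nbc) half_partner addrA.
rewrite (half_aligned _ cal nbc) cb.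
rewrite (negbTE (partner_neq cC c)) /= [inc b == _]eq_sym.
by case: eqVneq => [->|_]; rewrite ?irr ?F2_addrr // addr0.
Qed.

End Column.
End Fixed.

(** * Composition of modified interlacement matrices *)

Lemma ex_half_edge v : exists h : H, inc h = v.
Proof.
have := forallP reg v; case: (set_0Vmem (halves_at v)) => [->|[h]].
  by rewrite cards0.
by rewrite inE => /eqP; exists h.
Qed.

Lemma mod_interlace_mx_id (C : seq (seq H)) :
  euler_system C -> mod_interlace_mx C C = 1%:M%R.
Proof.
by move=> eC; apply/matrixP=> i j; rewrite !mxE /involves_phi eqxx.
Qed.

Lemma mod_interlace_mx_comp (C C' P : seq (seq H)) :
  euler_system C -> euler_system C' -> circuit_partition P ->
  mod_interlace_mx C' P = (mod_interlace_mx C' C *m mod_interlace_mx C P)%R.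
Proof.
move=> eC eC' cP; have cC := euler_circuit_partition eC.
apply/matrixP=> i j; rewrite [RHS]mxE; have [b bj] := ex_half_edge (enum_val j).
rewrite (mod_interlace_mx_half eC' cP i bj).
(* Row [i] of the product, as a combination of the half circuits of [C], is to
   be compared with the half circuit of [C'] at the vertex of [i]. *)
pose z h := (half C' (enum_val i) h
  + \sum_k mod_interlace_mx C' C i k * half C (enum_val k) h)%R.
have z_twin h : z (twin h) = z h.
  rewrite /z half_twin //; congr (_ + _)%R.
  by apply: eq_bigr => k _; rewrite half_twin.
have z_partner h : z (partner C h) = z h.
  rewrite /z.
  have hk : inc h = enum_val (enum_rank (inc h)) by rewrite enum_rankK.
  have -> :
    (\sum_k mod_interlace_mx C' C i k * half C (enum_val k) (partner C h)
    = \sum_k mod_interlace_mx C' C i k * half C (enum_val k) h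
      + mod_interlace_mx C' C i (enum_rank (inc h)))%R.
    under eq_bigr => k _ do rewrite half_partner // mulrDr.
    rewrite big_split /=; congr (_ + _)%R.
    rewrite (bigD1 (enum_rank (inc h))) //=.
    rewrite enum_rankK eqxx mulr1 big1 ?addr0 // => k nk.
    by rewrite -(inj_eq enum_rank_inj) enum_valK eq_sym (negbTE nk) mulr0.
  rewrite (mod_interlace_mx_half eC' cC i hk) [(half _ _ h + _)%R in LHS]addrC.
  by rewrite addrCA [X in (_ + X)%R]addrA F2_addrr add0r addrC.
under [RHS]eq_bigr => k _ do rewrite (mod_interlace_mx_half eC cP k bj) mulrDr.
rewrite big_split /=.
have := invariant_at_vertex eC z_twin z_partner (esym (inc_partner cP b)).
rewrite /z; set x := half _ _ b; set y := half _ _ _.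
set s := (\sum_k _)%R; set t := (\sum_k _)%R => xs_yt.
have -> : x = (y + t + s)%R by rewrite -xs_yt -addrA F2_addrr addr0.
by rewrite [LHS]addrC !addrA F2_addrr add0r addrC.
Qed.

End EulerSystem.

Theorem corollary8 (F : graph) (hF : four_regular F)
    (C C' : seq (seq (half_edge F)))
    (hC : euler_system C) (hC' : euler_system C') :
  mod_interlace_mx C' C \in unitmx /\
  (forall P : seq (seq (half_edge F)), circuit_partition P ->
     mod_interlace_mx C' P =
       (mod_interlace_mx C' C *m mod_interlace_mx C P)%R).
Proof.
split=> [|P]; last exact: mod_interlace_mx_comp.
have cC' := euler_circuit_partition hC'.
have e := mod_interlace_mx_comp hF hC hC' cC'.
rewrite (mod_interlace_mx_id hC') in e.
have [unit_CC _] := mulmx1_unit (esym e); exact: unit_CC.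
Qed.
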